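(* Let $R$ be a finite group of order $r$ and let $n\ge 71$ be an integer. The number of subsets $S\subseteq R$ for which there exist a non-identity proper normal subgroup $N$ of $R$ with $|N|\ge n$ and an automorphism $f\in\mathrm{Aut}(\Gamma(R,S))$ such that $f$ normalises $N$, $f\notin R$, and $f$ fixes setwise every $N$-orbit, is at most $2^{\,r-\frac{n}{4}+(\log_2 n)^2+(\log_2 r)^2+\log_2 r}$.
   Context: For a finite group $R$ and $S\subseteq R$, the Cayley digraph $\Gamma(R,S)$ has vertex set $R$ and $(g,h)$ is an arc iff $hg^{-1}\in S$. $R$ and its subgroups are identified with their images under the right regular representation in $\mathrm{Sym}(R)$; thus $R\le\mathrm{Aut}(\Gamma(R,S))$ and the $N$-orbits are the cosets of $N$. *)

(* Defs.v *)
From mathcomp Require Import all_boot all_order all_algebra all_fingroup.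
From mathcomp Require Import reals exp.

Set Implicit Arguments.
Unset Strict Implicit.
Unset Printing Implicit Defensive.

Import GroupScope.

(* A digraph on T is given by its arc relation, loops being allowed. *)
Definition digraph_aut (T : finType) (arc : rel T) : {set {perm T}} :=
  [set f : {perm T} | [forall x, forall y, arc (f x) (f y) == arc x y]].

Definition cayley_digraph (R : finGroupType) (S : {set R}) : rel R :=
  [rel g h | h * g^-1 \in S].

(* The image in Sym(R) of a subset of R under g |-> (x |-> x * g). *)
Definition regular_repr (R : finGroupType) (A : {set R}) : {set {perm R}} :=
  actperm 'R%act @* A.

Definition fixes_orbits (T : finType) (H : {set {perm T}}) (f : {perm T}) : bool :=
  [forall x, f @: orbit 'P%act H x == orbit 'P%act H x].

Definition log2 (K : realType) (x : K) : K := (ln x / ln 2)%R.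

(* Main.v *)
Require Import Defs.
From mathcomp Require Import all_boot all_order all_algebra all_fingroup.
From mathcomp Require Import reals sequences exp zify ring lra.
Import GroupScope Order.TTheory GRing.Theory Num.Theory.
Local Open Scope ring_scope.

(** Composing [f] with a right translation by an element of [N], we obtain an
    injection [h] of [R] that fixes 1, preserves [S] and every coset of [N], and
    satisfies [h (x n) = h x * h n] for [n] in [N].  If [h] is not the identity on
    [N], it induces a nontrivial automorphism of [N] stabilising [S]; this
    automorphism moves at least half of [N], so that at most [2^(r - |N|/4)] sets [S]
    are compatible with it, while [|Aut N| <= |N|^(log2 |N|)] because [N] has at most
    [log2 |N|] generators.  Otherwise [h] acts on some coset [N x] as the left
    multiplication by a nontrivial [a] in [N]; there are at most [r] pairs [(a, N x)]
    and each is compatible with at most [2^(r - |N|/2)] sets.  Finally [R] has at most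
    [r^(log2 r)] subgroups [N], and [|N| <= r/2] leaves a spare factor
    [2^(log2 |N|)], which makes the passage from [|N|] to [n] elementary. *)

(** * Subgroups and automorphisms counted through generating sets *)

Lemma leq_double_card_proper (gT : finGroupType) (H G : {group gT}) :
  H \proper G -> (2 * #|H| <= #|G|)%N.
Proof.
move=> /andP[sHG nsGH]; rewrite -(Lagrange sHG) mulnC leq_mul2l.
by rewrite indexg_gt1 nsGH orbT.
Qed.

(** Among the subsets [A] of [G] with [2 ^ #|A| <= #|<<A>>|], take one with [#|<<A>>|] maximal:
    adjoining an element of [G] outside [<<A>>] would at least double the generated subgroup. *)
Lemma small_generating_set (gT : finGroupType) (G : {group gT}) :
  exists A : {set gT}, <<A>> = G /\ (2 ^ #|A| <= #|G|)%N.
Proof.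
pose P (A : {set gT}) := (A \subset G) && (2 ^ #|A| <= #|<<A>>|)%N.
have P0 : P set0 by rewrite /P sub0set cards0 expn0 cardG_gt0.
case: (@arg_maxnP _ set0 P (fun A => #|<<A>>|) P0) => A /andP[sAG leA maxA].
exists A; have sgAG : <<A>> \subset G by rewrite gen_subG.
suff <- : <<A>> = G by [].
apply/eqP; rewrite eqEsubset sgAG; apply/subsetP => x Gx.
apply: contraT => nAx.
have xA : x \notin A by apply: contra nAx; apply: mem_gen.
have prA : <<A>> \proper <<x |: A>>.
  rewrite properE genS ?subsetUr //=; apply: contra nAx => /subsetP; apply.
  by rewrite mem_gen // setU11.
have := leq_double_card_proper _ _ _ prA => le2.
have := maxA (x |: A); rewrite /P subUset sub1set Gx sAG cardsU1 xA /=.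
rewrite expnD expn1 (leq_trans _ le2) ?leq_mul2l //= => /(_ isT).
by rewrite /= leqNgt (leq_trans _ le2) // mul2n -addnn -[ltnLHS]addn0 ltn_add2l cardG_gt0.
Qed.

(** Padding a small generating set with [1] gives families of a fixed length [d], so that subgroups
    and automorphisms can be counted by functions on ['I_d]. *)
Lemma generating_family (gT : finGroupType) (G : {group gT}) (d : nat) :
    (trunc_log 2 #|G| <= d)%N ->
  exists t : {ffun 'I_d -> gT}, <<t @: setT>> = G.
Proof.
move=> led; have [A [genA leA]] := small_generating_set _ G.
have ltA : (#|A| <= d)%N by apply: leq_trans led; apply: trunc_log_max.
exists [ffun i : 'I_d => nth 1%g (enum A) i].
apply/eqP; rewrite eqEsubset gen_subG; apply/andP; split.
  apply/subsetP => _ /imsetP[i _ ->]; rewrite ffunE.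
  have [lti | lei] := ltnP i (size (enum A)); last by rewrite nth_default.
  by rewrite -genA mem_gen // -mem_enum mem_nth.
rewrite -genA gen_subG; apply/subsetP => x Ax; rewrite mem_gen //.
have ltx : (index x (enum A) < size (enum A))%N by rewrite index_mem mem_enum.
have ltxd : (index x (enum A) < d)%N by apply: leq_trans ltA; rewrite cardE.
by apply/imsetP; exists (Ordinal ltxd); rewrite // ffunE /= nth_index ?mem_enum.
Qed.

Lemma card_groups_le (gT : finGroupType) :
  (#|{group gT}| <= #|gT| ^ trunc_log 2 #|gT|)%N.
Proof.
pose d := trunc_log 2 #|gT|; pose gen (t : {ffun 'I_d -> gT}) := [group of <<t @: setT>>].
rewrite -[X in (_ ^ X)%N]card_ord -card_ffun.
apply: leq_trans (leq_imset_card gen xpredT); apply/subset_leq_card/subsetP => G _.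
have [|t tG] := @generating_family _ G d.
  by apply: leq_trunc_log; apply: max_card.
by apply/imsetP; exists t => //; apply/val_inj.
Qed.

Lemma group_set_Aut_fixpoints (gT : finGroupType) (G : {group gT}) (a : {perm gT}) :
  a \in Aut G -> group_set [set x in G | a x == x].
Proof.
move=> Aa; apply/group_setP; split; first by rewrite !inE group1 -(autmE Aa) morph1 eqxx.
move=> x y; rewrite !inE => /andP[Gx /eqP ax] /andP[Gy /eqP ay].
by rewrite groupM // -{1}(autmE Aa) morphM //= autmE ax ay eqxx.
Qed.

(** Automorphisms [a] and [b] that agree on a generating family coincide: the fixed points of
    [a * b^-1] in [G] form a subgroup containing the family. *)
Lemma card_Aut_le (gT : finGroupType) (G : {group gT}) (d : nat) :
  (trunc_log 2 #|G| <= d)%N -> (#|Aut G| <= #|G| ^ d)%N.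
Proof.
case/generating_family => t tG.
have Gt i : t i \in G by rewrite -tG mem_gen // imset_f.
pose img (a : {perm gT}) := [ffun i => a (t i)].
rewrite -[X in (_ ^ X)%N]card_ord -card_ffun_on -(card_in_imset (f := img)).
  apply/subset_leq_card/subsetP => _ /imsetP[a Aa ->].
  by apply/ffun_onP => i; rewrite ffunE Aut_closed.
move=> a b Aa Ab /ffunP eqab; apply: (eq_Aut Aa Ab) => x Gx.
have Aab : (a * b^-1)%g \in Aut G by rewrite groupM ?groupV.
have sGfix : G \subset [set x in G | (a * b^-1)%g x == x].
  rewrite -{1}tG (gen_subG _ (Group (group_set_Aut_fixpoints _ _ _ Aab))) /=; apply/subsetP => _ /imsetP[i _ ->].
  by have := eqab i; rewrite !ffunE !inE Gt permM => ->; rewrite permK eqxx.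
have := subsetP sGfix x Gx; rewrite inE Gx permM => /eqP.
by move/(congr1 b); rewrite permKV.
Qed.

(** * Invariant sets counted through orbits *)

Lemma card_invariant_sets (T : finType) (p : {perm T}) :
  (#|[set S : {set T} | [forall x, (p x \in S) == (x \in S)]]| <= 2 ^ #|porbits p|)%N.
Proof.
rewrite -card_powerset.
pose img (S : {set T}) := porbit p @: S.
rewrite -(card_in_imset (f := img)); last first.
  move=> S1 S2; rewrite !inE => /forallP inv1 /forallP inv2 eqI; apply/setP => x.
  have mem_orb (S : {set T}) : (forall x, (p x \in S) == (x \in S)) ->
      (x \in S) = (porbit p x \in img S).
    move=> inv; apply/idP/imsetP => [Sx | [y Sy /eqP]]; first by exists x.
    rewrite eq_porbit_mem => /porbitP[i ->].
    elim: i => [|i IH]; first by rewrite expg0 perm1.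
    by rewrite expgSr permM (eqP (inv _)).
  by rewrite !mem_orb // eqI.
apply/subset_leq_card/subsetP => _ /imsetP[S _ ->]; rewrite inE.
by apply/subsetP => _ /imsetP[x _ ->]; apply: imset_f.
Qed.

(** Each orbit [O] satisfies [2 <= #|O| + (#|O| == 1)]; summing over the orbits bounds twice their
    number by [#|T|] plus the number of fixed points. *)
Lemma card_porbits_le (T : finType) (p : {perm T}) :
  (2 * #|porbits p| + #|[set x | p x != x]| <= 2 * #|T|)%N.
Proof.
have porbitE x : porbit p x = orbit 'P%act <[p]> x.
  by rewrite -{1}(actperm_id p) porbit_actperm ?inE.
have sumT : (\sum_(O in porbits p) #|O| = #|T|)%N.
  have actT : [acts <[p]>, on [set: T] | 'P%act].
    by apply/actsP => a _ x; rewrite !inE.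
  rewrite -cardsT -(acts_sum_card_orbit actT); apply: eq_bigl => O.
  by apply/imsetP/imsetP => -[x _ ->]; exists x; rewrite ?inE.
have le_fix : (#|[set O in porbits p | #|O| == 1]| <= #|[set x | p x == x]|)%N.
  apply: leq_trans (leq_imset_card set1 _); apply/subset_leq_card/subsetP => O.
  rewrite inE => /andP[/imsetP[x _ ->] /cards1P[y Oy]].
  have xy : x = y by apply/set1P; rewrite -Oy porbit_id.
  apply/imsetP; exists x; rewrite ?Oy ?xy // inE -in_set1 -xy.
  by rewrite {2}xy -Oy -{1}[p]expg1 mem_porbit.
have compl : (#|[set x | p x == x]| + #|[set x | p x != x]| = #|T|)%N.
  rewrite -(cardC [set x | p x == x]); congr (_ + _)%N.
  by apply: eq_card => x; rewrite !inE.
have : (\sum_(O in porbits p) 2 <= \sum_(O in porbits p) (#|O| + (#|O| == 1)))%N.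
  apply: leq_sum => _ /imsetP[x _ ->].
  by case: #|_| (card_porbit_neq0 p x) => [|[|k]].
rewrite big_split /= sumT sum_nat_const -big_mkcondr /= sum1dep_card.
move=> le_sum; have {le_sum} := leq_trans le_sum (leq_add (leqnn _) le_fix).
by rewrite -compl; move: (#|porbits p|) (#|[set x | p x == x]|) (#|[set x | p x != x]|); lia.
Qed.

Definition stable_sets (T : finType) (C : {set T}) (h : T -> T) : {set {set T}} :=
  [set S : {set T} | [forall x in C, (h x \in S) == (x \in S)]].

(** Extend [h] by the identity outside [C] to a permutation and count its orbits. The [.+1] allows
    [c] to be half the number of moved points rounded up, since the number of orbits is an
    integer. *)
Lemma card_stable_sets_le (T : finType) (C : {set T}) (h : T -> T) (c : nat) :
    {in C &, injective h} -> h @: C \subset C ->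
    (2 * c <= #|[set x in C | h x != x]|.+1)%N ->
  (#|stable_sets T C h| <= 2 ^ (#|T| - c))%N.
Proof.
move=> injh sCh lec; pose p := perm_in injh sCh.
have p_out x : x \notin C -> p x = x := out_perm (perm_in_on injh sCh).
have -> : stable_sets T C h = [set S : {set T} | [forall x, (p x \in S) == (x \in S)]].
  apply/setP => S; rewrite !inE; apply/forall_inP/forallP => [stS x | stS x Cx].
    have [Cx | /p_out ->//] := boolP (x \in C).
    by rewrite perm_inE ?stS.
  by have := stS x; rewrite perm_inE.
apply: leq_trans (card_invariant_sets _ p) _; rewrite leq_pexp2l //.
suff eq_moved : [set x in C | h x != x] = [set x | p x != x].
  have := card_porbits_le _ p; move: lec; rewrite eq_moved.
  by move: (#|porbits p|) (#|[set x | p x != x]|) (#|T|); lia.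
apply/setP => x; rewrite !inE; have [Cx | /p_out ->] := boolP (x \in C).
  by rewrite perm_inE.
by rewrite eqxx.
Qed.

(** The fixed points of [a] in [G] form a proper subgroup, so at least half of [G] is moved; the
    exponent subtracts [#|G| / 4] rounded up. *)
Lemma card_stable_sets_Aut_le (gT : finGroupType) (G : {group gT}) (a : {perm gT}) :
    a \in Aut G -> a != 1%g ->
  (#|stable_sets gT G a| <= 2 ^ (#|gT| - (#|G| + 3) %/ 4))%N.
Proof.
move=> Aa nta; apply: card_stable_sets_le.
- by move=> x y _ _; apply: perm_inj.
- by apply/subsetP => _ /imsetP[x Gx ->]; apply: Aut_closed.
have : Group (group_set_Aut_fixpoints _ _ _ Aa) \proper G.
  have sfixG : [set x in G | a x == x] \subset G by apply/subsetP => x; rewrite inE => /andP[].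
  rewrite properEneq sfixG andbT; apply: contra nta => /eqP/= fixG.
  apply/eqP/(eq_Aut Aa (group1 _)) => x; rewrite perm1 -{1}fixG inE.
  by case/andP=> _ /eqP.
move/leq_double_card_proper => /=.
have : (#|[set x in G | a x == x]| + #|[set x in G | a x != x]|)%N = #|G|.
  rewrite -[RHS](cardsID [set x | a x == x]).
  by congr (_ + _)%N; apply: eq_card => x; rewrite !inE // andbC.
move: (#|[set x in G | a x == x]|) (#|[set x in G | a x != x]|) (#|G|) => u v w.
lia.
Qed.

(** Left multiplication by [a] preserves the right coset [C] and has no fixed point on it. *)
Lemma card_stable_sets_mulg_le (gT : finGroupType) (G : {group gT}) (a : gT) (C : {set gT}) :
    a \in G -> a != 1%g -> C \in rcosets G setT ->
  (#|stable_sets gT C (fun x => a * x)%g| <= 2 ^ (#|gT| - (#|G| + 1) %/ 2))%N.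
Proof.
move=> Ga nta /rcosetsP[z _ ->]; apply: card_stable_sets_le.
- by move=> x y _ _; apply: mulgI.
- apply/subsetP => _ /imsetP[x Cx ->]; rewrite mem_rcoset -mulgA.
  by rewrite groupM // -mem_rcoset.
suff -> : [set x in G :* z | (a * x)%g != x] = G :* z.
  by rewrite card_rcoset; move: (#|G|); lia.
apply/setP => x; rewrite inE; case: (x \in _) => //=.
by rewrite -{2}[x]mul1g (inj_eq (mulIg x)).
Qed.

(** * From a normalising automorphism to a stable set *)

Lemma stable_sets_of_normalising_aut (gT : finGroupType) (S : {set gT})
    (N : {group gT}) (f : {perm gT}) :
    N <| [set: gT] ->
    f \in digraph_aut (cayley_digraph S) -> f \in 'N(regular_repr N) ->
    f \notin regular_repr [set: gT] -> fixes_orbits (regular_repr N) f ->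
  (exists2 a, a \in Aut N :\ 1%g & S \in stable_sets gT N a)
  \/ (exists2 aC, aC \in setX N^# (rcosets N setT) & S \in stable_sets gT aC.2 (fun x => aC.1 * x)%g).
Proof.
case/andP=> _ /subsetP nN; rewrite inE => /forallP autf normf nregf fixf.
have repr_mem (A : {set gT}) (n : gT) : n \in A -> actperm 'R%act n \in regular_repr A.
  by move=> An; rewrite mem_morphim ?inE.
have reprP (A : {set gT}) p : p \in regular_repr A -> exists2 n, n \in A & forall x, p x = (x * n)%g.
  by case/morphimP=> n _ An ->; exists n => // x; rewrite actpermE.
(* Conjugating the right translation by [n] with [f] gives the right translation by some [n'] in
   [N]. *)
have fM n : n \in N -> exists2 n', n' \in N & forall x, f (x * n)%g = (f x * n')%g.
  move=> /repr_mem; rewrite -(memJ_norm _ normf) => /reprP[n' Nn' jE].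
  by exists n' => // y; rewrite -jE !permM permK actpermE.
have fN x : (x^-1 * f x)%g \in N.
  have : f x \in orbit 'P%act (regular_repr N) x.
    rewrite -(eqP (forallP fixf x)) imset_f //.
    exact: (orbit_refl 'P%act [group of actperm 'R%act @* N]).
  case/orbitP => p /reprP[n Nn pE]; rewrite /= apermE pE => <-.
  by rewrite mulKg.
pose h x := (f x * (f 1)^-1)%g.
have Nf1 : f 1%g \in N by have := fN 1%g; rewrite invg1 mul1g.
have hM x n : n \in N -> h (x * n)%g = (h x * h n)%g.
  move=> /fM[n' _ fn]; have := fn 1%g; rewrite mul1g => fn1.
  rewrite /h fn fn1.
  by rewrite !mulgA mulgKV.
have h_inj : injective h by move=> x y /mulIg/perm_inj.
have hN x : (x^-1 * h x)%g \in N by rewrite mulgA groupM ?groupV.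
(* Arcs leaving [1] are mapped to arcs leaving [f 1]. *)
have hS x : (h x \in S) = (x \in S).
  by have /forallP/(_ x)/eqP := autf 1%g; rewrite /cayley_digraph /= invg1 mulg1.
have h1 : h 1%g = 1%g by rewrite /h mulgV.
have [x hx] : exists x, h x != x.
  (* Were [h] the identity, [f] would be the right translation by [f 1]. *)
  apply/existsP; apply: contraNT nregf; rewrite negb_exists => /forallP hid.
  have -> : f = actperm 'R%act (f 1%g); last by rewrite repr_mem ?inE.
  apply/permP => x; rewrite actpermE /= -{2}(eqP (negbNE (hid x))).
  by rewrite /h mulgKV.
have stable_eq (C : {set gT}) k : {in C, h =1 k} -> S \in stable_sets gT C k.
  by move=> hk; rewrite inE; apply/forall_inP => y Cy; rewrite -hk ?hS.
have [/forall_inP hN1 | /forall_inPn[y Ny hy]] := boolP [forall y in N, h y == y].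
  (* By normality each [y] in [N :* x] is [x * n] with [n] in [N], so [h y = h x * n], which is [y]
     multiplied on the left by [h x * x^-1]. *)
  right; exists ((h x * x^-1)%g, N :* x).
    rewrite in_setX /= !in_setD1 -eq_mulgV1 hx andTb; apply/andP; split.
      have := hN x; rewrite -(memJ_norm _ (nN x^-1%g _)) ?inE //.
      by rewrite conjgE invgK !mulgA mulgV mul1g.
    by apply/rcosetsP; exists x; rewrite ?inE.
  apply: stable_eq => y /=; rewrite norm_rlcoset ?nN ?inE // => /lcosetP[n Nn ->].
  by rewrite hM // (eqP (hN1 n Nn)) !mulgA mulgKV.
left; have hNN : h @: N \subset N.
  apply/subsetP => _ /imsetP[n Nn ->]; rewrite -(mulKVg n (h n)).
  by rewrite groupM.
(* Elements of [Aut N] are permutations of the whole group that fix every point outside [N], hence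
   the extension of [h] by the identity. *)
pose a := perm_in (in2W h_inj) hNN.
have aE : {in N, h =1 a} by move=> n Nn; rewrite perm_inE.
exists a; last exact: stable_eq.
rewrite !inE perm_in_on; apply/andP; split.
  by apply: contra hy => /eqP a1; rewrite aE // a1 perm1.
by apply/morphicP => n1 n2 Nn1 Nn2; rewrite -!aE ?groupM // hM.
Qed.

(** * Union bound for a fixed normal subgroup *)

Lemma card_bigcup_le (I T : finType) (A : {pred I}) (F : I -> {set T}) :
  (#|\bigcup_(i in A) F i| <= \sum_(i in A) #|F i|)%N.
Proof.
elim/big_rec2: _ => [|i k B _ leB]; first by rewrite cards0.
by rewrite (leq_trans (leq_card_setU _ _)) ?leq_add2l.
Qed.

Lemma card_bigcup_le_const (I T : finType) (A : {pred I}) (F : I -> {set T}) (c : nat) :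
  (forall i, i \in A -> #|F i| <= c)%N -> (#|\bigcup_(i in A) F i| <= #|A| * c)%N.
Proof.
move=> leF; apply: leq_trans (card_bigcup_le _ _ _ _) _.
by rewrite -sum_nat_const leq_sum.
Qed.

Definition normalising_sets (gT : finGroupType) (N : {group gT}) : {set {set gT}} :=
  [set S : {set gT} | [exists f : {perm gT},
     [&& f \in digraph_aut (cayley_digraph S), f \in 'N(regular_repr N),
         f \notin regular_repr [set: gT] & fixes_orbits (regular_repr N) f]]].

Lemma card_normalising_sets_le (gT : finGroupType) (N : {group gT}) :
    N <| [set: gT] ->
  (#|normalising_sets gT N| <=
     #|N| ^ trunc_log 2 #|N| * 2 ^ (#|gT| - (#|N| + 3) %/ 4)
     + #|gT| * 2 ^ (#|gT| - (#|N| + 1) %/ 2))%N.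
Proof.
move=> nN; pose mulC (aC : gT * {set gT}) := stable_sets gT aC.2 (fun x => aC.1 * x)%g.
pose UA := \bigcup_(a in Aut N :\ 1%g) stable_sets gT N a.
pose UC := \bigcup_(aC in setX N^# (rcosets N setT)) mulC aC.
have sub : normalising_sets gT N \subset UA :|: UC.
  apply/subsetP => S; rewrite !inE => /existsP[f /and4P[autf normf nregf fixf]].
  apply/orP; have [] := stable_sets_of_normalising_aut _ _ _ _ nN autf normf nregf fixf.
    by case=> a Aa Sa; left; apply/bigcupP; exists a.
  by case=> aC AaC SaC; right; apply/bigcupP; exists aC.
apply: leq_trans (subset_leq_card sub) _.
apply: leq_trans (leq_card_setU _ _) (leq_add _ _).
  apply: leq_trans (leq_mul (card_Aut_le _ N _ (leqnn _)) (leqnn _)).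
  apply: leq_trans (leq_mul (subset_leq_card (subsetDl _ [set 1%g])) (leqnn _)).
  apply: card_bigcup_le_const => a; rewrite in_setD1 => /andP[nta Aa].
  exact: card_stable_sets_Aut_le.
apply: (@leq_trans (#|setX N^# (rcosets N setT)| * 2 ^ (#|gT| - (#|N| + 1) %/ 2))).
  apply: card_bigcup_le_const => -[a C].
  rewrite in_setX /= in_setD1 => /andP[/andP[nta Na] CN].
  exact: card_stable_sets_mulg_le.
(* By Lagrange, [#|N|] times the number of cosets is the order of the whole group. *)
rewrite leq_mul2r cardsX -[#|gT|]cardsT -(Lagrange (subsetT N)) leq_mul2r.
by rewrite subset_leq_card ?orbT // subsetDl.
Qed.

(** * Real estimates *)

Lemma ln2_ge_half (K : realType) : 2^-1 <= ln 2 :> K.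
Proof.
rewrite -ler_expR lnK ?posrE // -[2^-1]opprK expRN invf_ple ?posrE ?expR_gt0 //.
by apply: le_trans (expR_ge1Dx _); lra.
Qed.

(** The left side is the part of degree at most 2 of [(1 + t / 8) ^+ 4], which is at most
    [expR (t / 8) ^+ 4 = expR (t / 2)]. *)
Lemma powR2_ge (K : realType) (t : K) : 0 <= t ->
  1 + t / 2 + 3 * t ^+ 2 / 32 <= 2 `^ t.
Proof.
move=> t0; have le1 : 1 + t / 8 <= expR (t / 8) := expR_ge1Dx _.
have : (1 + t / 8) ^+ 4 <= expR (t / 2).
  have -> : t / 2 = 4%:R * (t / 8) by lra.
  by rewrite expRM_natl lerXn2r ?nnegrE ?expR_ge0 //; lra.
have : expR (t / 2) <= 2 `^ t.
  rewrite /powR pnatr_eq0 /= ler_expR ler_wpM2l //; exact: ln2_ge_half.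
move=> ge1 ge2; apply: le_trans (le_trans ge2 ge1).
have -> : (1 + t / 8) ^+ 4 =
  1 + t / 2 + 3 * t ^+ 2 / 32 + t ^+ 3 / 128 + t ^+ 4 / 4096 by field.
by have := exprn_ge0 3 t0; have := exprn_ge0 4 t0; lra.
Qed.

Lemma powR2_log2 (K : realType) (x : K) : 0 < x -> 2 `^ log2 x = x.
Proof.
move=> x0; rewrite /powR pnatr_eq0 /= /log2 mulfVK ?lnK //.
by rewrite gt_eqF // ln_gt0 // ltr1n.
Qed.

Lemma log2_powR (K : realType) (t : K) : log2 (2 `^ t) = t.
Proof. by rewrite /log2 ln_powR mulfK // gt_eqF // ln_gt0 // ltr1n. Qed.

Lemma ler_log2 (K : realType) (x y : K) : 0 < x -> x <= y -> log2 x <= log2 y.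
Proof.
move=> x0 xy; rewrite ler_pM2r ?invr_gt0 ?ln_gt0 ?ltr1n // ler_ln // posrE //.
exact: lt_le_trans xy.
Qed.

(* The term [- b] is the spare factor mentioned above: with it, the crude bound
   [ln 2 >= 1/2] suffices, whereas without it the inequality is tight near 71. *)
Lemma sqr_sub_powR2_le (K : realType) (a b : K) : 6 <= a -> a <= b ->
  b ^+ 2 - b - 2 `^ b / 4 <= a ^+ 2 - 2 `^ a / 4.
Proof.
move=> a6 ab; pose s := a - 6; pose t := b - a.
have [s0 t0] : 0 <= s /\ 0 <= t by rewrite !subr_ge0.
have -> : b = a + t by rewrite addrC subrK.
have -> : a = 6 + s by rewrite addrC subrK.
have E64 : 2 `^ 6 = 64 :> K by rewrite (powR_mulrn 6) // -natrX.
have E64D (u : K) : 2 `^ (6 + u) = 64 * 2 `^ u by rewrite powRD ?E64 // pnatr_eq0 implybT.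
have tD (u : K) : 2 `^ (u + t) = 2 `^ u * 2 `^ t by rewrite powRD // pnatr_eq0 implybT.
rewrite tD E64D.
have Es := powR2_ge _ _ s0; have Et := powR2_ge _ _ t0.
(* Since [64 / 4 = 16], the goal amounts to [11 * t + 2 * s * t + t ^+ 2 - 6 - s <= 16 * 2]^ s * (2
   [^ t - 1)]; a bound linear in [s] and quadratic in [t] suffices on the right. *)
have le_prod : (1 + s / 2) * (t / 2 + 3 * t ^+ 2 / 32) <= 2 `^ s * (2 `^ t - 1).
  have := sqr_ge0 s; have := sqr_ge0 t => t2 s2.
  by apply: ler_pM; lra.
have : 0 <= 16 * (1 + s / 2) * (t / 2 + 3 * t ^+ 2 / 32) - (11 * t + 2 * s * t + t ^+ 2 - 6 - s).
  have -> : 16 * (1 + s / 2) * (t / 2 + 3 * t ^+ 2 / 32) - (11 * t + 2 * s * t + t ^+ 2 - 6 - s)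
     = (t - 3) ^+ 2 / 2 + 3 / 2 + s + 2 * (s * t) + 3 / 4 * (s * t ^+ 2) by field.
  have := mulr_ge0 s0 t0; have := mulr_ge0 s0 (sqr_ge0 t); have := sqr_ge0 (t - 3); lra.
nra.
Qed.

Lemma trunc_log_le_log2 (K : realType) (m : nat) : (0 < m)%N ->
  (trunc_log 2 m)%:R <= log2 m%:R :> K.
Proof.
move=> m0; rewrite -[leLHS]log2_powR ler_log2 ?powR_gt0 ?ltr0n //.
by rewrite powR_mulrn ?ler0n // -natrX ler_nat trunc_logP.
Qed.

Lemma expn_trunc_log_le (K : realType) (m : nat) : (0 < m)%N ->
  (m ^ trunc_log 2 m)%:R <= 2 `^ (log2 m%:R ^+ 2) :> K.
Proof.
move=> m0; have L0 : 0 <= log2 m%:R :> K.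
  exact: le_trans (ler0n _ _) (trunc_log_le_log2 K _ m0).
rewrite expr2 powRrM powR2_log2 ?ltr0n // natrX -powR_mulrn ?ler0n //.
by rewrite ler_powR ?ler1n // trunc_log_le_log2.
Qed.

Lemma expn2_subn_le (K : realType) (r c : nat) (x : K) :
  (c <= r)%N -> x <= c%:R -> (2 ^ (r - c))%:R <= 2 `^ (r%:R - x).
Proof.
move=> cr xc; rewrite natrX -powR_mulrn ?ler0n // ler_powR ?ler1n // natrB //.
by rewrite lerB.
Qed.

Lemma normalising_sets_estimate (K : realType) (m n r : nat) :
    (71 <= n)%N -> (n <= m)%N -> (2 * m <= r)%N ->
  (m ^ trunc_log 2 m * 2 ^ (r - (m + 3) %/ 4) + r * 2 ^ (r - (m + 1) %/ 2))%:R
  <= 2 `^ (r%:R - n%:R / 4 + (log2 n%:R) ^+ 2 + log2 r%:R) :> K.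
Proof.
move=> n71 nm mr; have m0 : (0 < m)%N by lia.
have r0 : (0 < r)%N by lia.
set a := log2 n%:R; set b := log2 m%:R : K.
have a6 : 6 <= a.
  have -> : 6 = log2 (2 `^ 6%:R) :> K by rewrite log2_powR.
  rewrite ler_log2 ?powR_gt0 // powR_mulrn // -natrX ler_nat; lia.
have ab : a <= b by rewrite ler_log2 ?ltr0n ?ler_nat //; lia.
have := sqr_sub_powR2_le _ _ _ a6 ab; rewrite !powR2_log2 ?ltr0n //; last by lia.
move=> key; set X := 2 `^ (r%:R - n%:R / 4 + a ^+ 2).
have -> : 2 `^ (r%:R - n%:R / 4 + a ^+ 2 + log2 r%:R) = r%:R * X.
  by rewrite powRD ?pnatr_eq0 ?implybT // powR2_log2 ?ltr0n // mulrC.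
have mrK : 2 * m%:R <= r%:R :> K by rewrite -natrM ler_nat.
have nmK : n%:R <= m%:R :> K by rewrite ler_nat.
have nK : 71 <= n%:R :> K by rewrite ler_nat.
have le_aut : (m ^ trunc_log 2 m * 2 ^ (r - (m + 3) %/ 4))%:R <= m%:R * X.
  rewrite natrM; apply: (@le_trans _ _ (2 `^ (b ^+ 2) * 2 `^ (r%:R - m%:R / 4))).
    rewrite ler_pM ?ler0n ?expn_trunc_log_le // expn2_subn_le //; first by lia.
    by rewrite ler_pdivrMr // -natrM ler_nat; lia.
  rewrite -[m%:R in leRHS]powR2_log2 ?ltr0n // -!powRD ?pnatr_eq0 ?implybT //.
  by rewrite ler_powR ?ler1n // -/b; lra.
(* As [m / 2] exceeds [n / 4] by more than 1, half of [r * X] suffices here; [m <= r / 2] leaves the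
   other half for [le_aut]. *)
have le_shift : (r * 2 ^ (r - (m + 1) %/ 2))%:R <= r%:R * (X / 2).
  rewrite natrM ler_wpM2l // ler_pdivlMr //.
  apply: (@le_trans _ _ (2 `^ (r%:R - m%:R / 2) * 2 `^ 1)).
    rewrite powRr1 // ler_pM2r // expn2_subn_le //; first by lia.
    by rewrite ler_pdivrMr // -natrM ler_nat; lia.
  rewrite -powRD ?pnatr_eq0 ?implybT // ler_powR ?ler1n //.
  by have := sqr_ge0 a; lra.
rewrite natrD; apply: le_trans (lerD le_aut le_shift) _.
have : 0 <= X := powR_ge0 _ _; nra.
Qed.

(** * Summation over the normal subgroups *)

Theorem theorem2p4 (K : realType) (R : finGroupType) (r n : nat)
    (hr : #|[set: R]| = r) (hn : (71 <= n)%N) :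
  (#|[set S : {set R} |
      [exists N : {group R},
        [&& N :!=: 1%g, N \proper [set: R], N <| [set: R], (n <= #|N|)%N &
          [exists f : {perm R},
            [&& f \in digraph_aut (cayley_digraph S),
                f \in 'N(regular_repr N),
                f \notin regular_repr [set: R] &
                fixes_orbits (regular_repr N) f]]]]]|%:R : K)
  <= 2 `^ (r%:R - n%:R / 4 + (log2 n%:R) ^+ 2 + (log2 r%:R) ^+ 2 + log2 r%:R).
Proof.
have r0 : (0 < r)%N by rewrite -hr cardG_gt0.
pose good (N : {group R}) := [&& N \proper [set: R], N <| [set: R] & (n <= #|N|)%N].
set X := r%:R - n%:R / 4 + log2 n%:R ^+ 2 : K.
set bad := finset _.
have sub : bad \subset \bigcup_(N in good) normalising_sets R N.
  apply/subsetP => S; rewrite inE => /existsP[N /and5P[_ prN nN leN hf]].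
  by apply/bigcupP; exists N; rewrite ?inE // unfold_in /good prN nN leN.
have le_sum := leq_trans (subset_leq_card sub) (card_bigcup_le _ _ _ _).
apply: (@le_trans _ _ (\sum_(N in good) 2 `^ (X + log2 r%:R))).
  apply: le_trans (_ : (\sum_(N in good) #|normalising_sets R N|)%N%:R <= _).
    by rewrite ler_nat.
  rewrite natr_sum; apply: ler_sum => N /and3P[prN nN leN].
  have le2 : (2 * #|N| <= r)%N by rewrite -hr leq_double_card_proper.
  apply: le_trans (normalising_sets_estimate K _ _ _ hn leN le2).
  by rewrite ler_nat -hr cardsT card_normalising_sets_le.
rewrite sumr_const -[_ *+ _]mulr_natl.
have -> : X + log2 r%:R ^+ 2 + log2 r%:R = log2 r%:R ^+ 2 + (X + log2 r%:R) by ring.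
rewrite [leRHS]powRD ?pnatr_eq0 ?implybT // ler_wpM2r ?powR_ge0 //.
apply: le_trans (expn_trunc_log_le K _ r0); rewrite ler_nat.
by apply: leq_trans (max_card _) _; rewrite -hr cardsT card_groups_le.
Qed.
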